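(* For every $\varepsilon\in(0,1)$ there exist positive integers $n$ and $K$, a real number $\mu>0$, and (nonempty) classes $\mathcal{A}\subset\mathcal{C}$ of subsets of $\{1,\ldots,n\}$, all of whose members have cardinality $K$, such that $$R^*_{\mathcal{A}}(\mu)\ge 1-\varepsilon\quad\text{and}\quad R^*_{\mathcal{C}}(\mu)\le 2\varepsilon.$$
   Context: Setting: for a class $\mathcal{L}$ of $|\mathcal{L}|\ge 1$ distinct subsets of $\{1,\ldots,n\}$, all of cardinality $K$, and $\mu>0$: under $\mathbb{P}_0$ the components of the random vector $\mathbf{X}=(X_1,\ldots,X_n)$ are independent standard normal; for $S\in\mathcal{L}$, under $\mathbb{P}_S$ the components are independent with $X_i\sim\mathcal{N}(\mu,1)$ for $i\in S$ and $X_i\sim\mathcal{N}(0,1)$ for $i\notin S$. The risk of a (measurable) test $f:\mathbb{R}^n\to\{0,1\}$ for the class $\mathcal{L}$ is $$R_{\mathcal{L}}(f)=\mathbb{P}_0\{f(\mathbf{X})=1\}+\frac1{|\mathcal{L}|}\sum_{S\in\mathcal{L}}\mathbb{P}_S\{f(\mathbf{X})=0\},$$ and $R^*_{\mathcal{L}}(\mu)$ is the minimum of $R_{\mathcal{L}}(f)$ over all tests $f$. Equivalently, $R^*_{\mathcal{L}}(\mu)=1-\frac12\int|\phi_0(\mathbf{x})-\phi_{\mathcal{L}}(\mathbf{x})|\,d\mathbf{x}$, where $\phi_0$ and $\phi_S$ are the densities of $\mathbf{X}$ under $\mathbb{P}_0$ and $\mathbb{P}_S$ and $\phi_{\mathcal{L}}=\frac1{|\mathcal{L}|}\sum_{S\in\mathcal{L}}\phi_S$.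 *)

(* Defs.v *)
From HB Require Import structures.
From mathcomp Require Import all_boot all_order all_algebra.
From mathcomp Require Import all_classical all_reals all_analysis.

Set Implicit Arguments.
Unset Strict Implicit.
Unset Printing Implicit Defensive.

Import Order.TTheory GRing.Theory Num.Theory.
Local Open Scope classical_set_scope.
Local Open Scope ring_scope.

Section product_probability.
Context {d : measure_display} {T : measurableType d} {R : realType}.

Definition tuple_cons n (x : T * n.-tuple T) : n.+1.-tuple T :=
  [the n.+1.-tuple T of x.1 :: x.2].

Lemma measurable_tuple_cons n : measurable_fun [set: _] (@tuple_cons n).
Proof. exact: measurable_cons. Qed.

HB.instance Definition _ n :=
  isMeasurableFun.Build _ _ _ _ (@tuple_cons n) (@measurable_tuple_cons n).

(* The law of (X_0, ..., X_(n-1)) for independent X_i with laws P i; see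
   tuple_probE for its characterization on boxes. *)
Fixpoint tuple_prob n : ('I_n -> probability T R) -> probability (n.-tuple T) R :=
  match n with
  | 0 => fun=> \d_[tuple]
  | m.+1 => fun P =>
      distribution (P ord0 \x tuple_prob (fun i : 'I_m => P (lift ord0 i)))%E
        (@tuple_cons m)
  end.

Lemma tuple_probE n (P : 'I_n -> probability T R) (A : 'I_n -> set T) :
  (forall i, measurable (A i)) ->
  tuple_prob P [set x | forall i, A i (tnth x i)] = (\prod_(i < n) P i (A i))%E.
Proof.
elim: n P A => [|n IHn] P A mA /=.
  by rewrite big_ord0 diracE mem_set// => -[].
rewrite big_ord_recl -(IHn (fun i => P (lift ord0 i)) (fun i => A (lift ord0 i)))//.
rewrite -product_measure1E//; last first.
  rewrite [X in measurable X](_ : _ =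
    \bigcap_(i in [set: 'I_n]) ((@tnth n T ^~ i) @^-1` A (lift ord0 i))).
    apply: fin_bigcap_measurable; first exact: finite_finset.
    move=> i _; rewrite -[X in measurable X]setTI.
    exact: measurable_tnth.
  by apply/seteqP; split=> x /= Hx i; [move=> _; exact: Hx|exact: (Hx i)].
rewrite /distribution /pushforward; congr (product_measure1 _ _ _).
apply/seteqP; split=> -[x t] /=.
  move=> H; split=> [|i]; first exact: (H ord0).
  by have := H (lift ord0 i); rewrite tnthS.
move=> [Hx Ht] i; case: (unliftP ord0 i) => [j|] -> //.
by rewrite tnthS; exact: Ht.
Qed.

End product_probability.
Arguments tuple_prob {d T R n} P.

Section testing.
Context {R : realType} {n : nat}.
Local Notation Rn := (n.-tuple (measurableTypeR R)).
Implicit Types (mu : R) (S : {set 'I_n}) (L : {set {set 'I_n}}).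

Definition P0 : probability Rn R :=
  tuple_prob (fun=> normal_prob 0 1 : probability (measurableTypeR R) R).

Definition PS mu S : probability Rn R :=
  tuple_prob (fun i =>
    normal_prob (if i \in S then mu else 0) 1
      : probability (measurableTypeR R) R).

Definition risk mu L (f : Rn -> bool) : R :=
  fine (P0 [set x | f x = true]) +
  #|L|%:R^-1 * \sum_(S in L) fine (PS mu S [set x | f x = false]).

(* An infimum over measurable tests, which is attained: see
   optimal_risk_attained. *)
Definition optimal_risk mu L : R :=
  inf [set risk mu L f | f in [set f | measurable_fun [set: Rn] f]].

Lemma risk_ge0 mu L f : 0 <= risk mu L f.
Proof.
rewrite addr_ge0 ?fine_ge0// mulr_ge0 ?invr_ge0 ?ler0n// sumr_ge0// => S _.
exact: fine_ge0.
Qed.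

Let signed mu L (s : seq {set 'I_n}) : exists nu : {charge set Rn -> \bar R},
  forall A, measurable A -> fine (nu A) =
    fine (P0 A) - #|L|%:R^-1 * \sum_(S <- s) fine (PS mu S A).
Proof.
elim: s => [|S s [nu nuE]].
  exists (charge_of_finite_measure P0) => A mA.
  by rewrite big_nil mulr0 subr0.
exists (cadd nu (cscale (- #|L|%:R^-1) (charge_of_finite_measure (PS mu S)))).
move=> A mA; have fS := fin_num_measure (PS mu S) A mA.
rewrite /cadd /cscale /= fineD ?fin_numM ?(fin_num_measure nu)//.
rewrite fineM// nuE// big_cons /= mulrDr mulNr.
by rewrite opprD addrA addrAC.
Qed.

Lemma optimal_risk_attained mu L :
  exists f : Rn -> bool, [/\ measurable_fun [set: Rn] f,
    risk mu L f = optimal_risk mu L &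
    forall g : Rn -> bool, measurable_fun [set: Rn] g ->
      risk mu L f <= risk mu L g].
Proof.
have [nu nuE] := signed mu L (enum L).
have mtrue (g : Rn -> bool) : measurable_fun [set: Rn] g ->
    measurable [set x | g x = true].
  by move=> mg; rewrite -[X in measurable X]setTI; exact: (mg _ [set true]).
have riskE (g : Rn -> bool) : measurable_fun [set: Rn] g -> risk mu L g =
    fine (nu [set x | g x = true]) + #|L|%:R^-1 * \sum_(S in L) 1.
  move=> /mtrue mg; rewrite nuE// big_enum/= -addrA /risk; congr (_ + _).
  rewrite addrC -mulrBr -sumrB; congr (_ * _); apply: eq_bigr => S _.
  rewrite (_ : [set x | g x = false] = ~` [set x | g x = true]); last first.
    by apply/seteqP; split=> x /=; case: (g x).
  by rewrite probability_setC// fineB// fin_num_measure.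
have [P [N [[mP posP] [mN negN] PN PN0]]] := Hahn_decomposition nu.
pose f (x : Rn) : bool := x \in N.
have mf : measurable_fun [set: Rn] f.
  by apply: (measurable_fun_bool true); rewrite setTI preimage_mem_true.
have fE : [set x | f x = true] = N.
  by apply/seteqP; split=> x; rewrite /f /= => /set_mem || move/mem_set.
have fmin g : measurable_fun [set: Rn] g -> risk mu L f <= risk mu L g.
  move=> mg; rewrite !riskE// lerD2r fE.
  have mA := mtrue _ mg; set A := [set x | g x = true] in mA *.
  apply: fine_le; rewrite ?fin_num_measure//.
  rewrite (charge_partition nu mA mP mN PN PN0) (chargeDI nu mN mA) setIC.
  apply: leeD2r; apply: (@le_trans _ _ 0%E).
    by apply: negN; [exact: measurableD|exact: subDsetl].
  by apply: posP; [exact: measurableI|exact: subIsetr].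
exists f; split => //; apply/eqP; rewrite eq_le; apply/andP; split.
- by apply: lb_le_inf; [exists (risk mu L f), f|move=> _ [g mg <-]; exact: fmin].
- apply: ge_inf; last by exists f.
  by exists 0 => _ [g _ <-]; exact: risk_ge0.
Qed.

End testing.
Arguments P0 {R n}.

(* Main.v *)
Require Import Defs.
From mathcomp Require Import all_boot all_order all_algebra.
From mathcomp Require Import all_classical all_reals all_analysis.
From mathcomp Require Import measurable_realfun ring lra zify.

(* Take K = 2. The class A consists of N disjoint pairs; its members have
   pairwise uncorrelated likelihood ratios of second moment exp(2 mu^2), so the
   mixture of the P_S is close to P_0 once N is large and no test does well.
   Adding m further pairs {0, j} that all share the point 0 makes the problem
   easy as soon as m >> N and mu is large: rejecting when X_0 > mu/2 detects
   every new pair, and the pairs of A become a negligible part of the class. *)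

Set Implicit Arguments.
Unset Strict Implicit.
Unset Printing Implicit Defensive.

Import Order.TTheory GRing.Theory Num.Theory.
Local Open Scope classical_set_scope.
Local Open Scope ring_scope.

(** * Change of mean for one-dimensional Gaussian laws *)

Section gaussian_tilting.
Context {R : realType}.
Local Notation TR := (measurableTypeR R).
Local Notation gauss m := (normal_prob m 1 : probability TR R).

(** The abstract Radon-Nikodym derivative and [normal_pdf] have the same integral over every
    measurable set, so they agree almost everywhere and may be exchanged under the integral. *)
Lemma ge0_integral_normal_prob (m : R) (f : R -> \bar R) :
  measurable_fun [set: R] f -> (forall x, 0 <= f x)%E ->
  (\int[gauss m]_x f x =
   \int[@lebesgue_measure R : {measure set TR -> \bar R}]_x
     (f x * (normal_pdf m 1 x)%:E))%E.
Proof.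
move=> mf f0; have dom := normal_prob_dominates m (1 : R).
rewrite -(Radon_Nikodym_SigmaFinite.change_of_variables dom)//.
have mRN := Radon_Nikodym_SigmaFinite.f_integrable dom.
have mpdf : measurable_fun [set: R] (fun x => (normal_pdf m 1 x)%:E).
  by apply/measurable_EFinP; exact: measurable_normal_pdf.
apply: ae_eq_integral => //.
- by apply: emeasurable_funM => //; exact: measurable_int mRN.
- exact: emeasurable_funM.
- apply: ae_eqe_mul2l.
  apply: integral_ae_eq => // E _ mE.
  by rewrite -Radon_Nikodym_SigmaFinite.f_integral.
Qed.

(** The density of the normal law of mean [t] with respect to the one of mean 0, both of variance
    1. *)
Definition gauss_lr (t x : R) : R := expR (t * x - t ^+ 2 / 2).

Lemma measurable_gauss_lr t : measurable_fun [set: R] (gauss_lr t).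
Proof.
by apply: measurableT_comp => //; exact: measurable_funB.
Qed.

Lemma ge0_integral_normal_tilt (t : R) (f : R -> \bar R) :
  measurable_fun [set: R] f -> (forall x, 0 <= f x)%E ->
  (\int[gauss t]_x f x =
   \int[gauss 0]_x (f x * (gauss_lr t x)%:E))%E.
Proof.
move=> mf f0; rewrite !ge0_integral_normal_prob//; last 2 first.
- apply: emeasurable_funM => //.
  by apply/measurable_EFinP; exact: measurable_gauss_lr.
- by move=> x; rewrite mule_ge0// lee_fin expR_ge0.
apply: eq_integral => x _; rewrite -muleA -EFinM; congr (_ * _%:E)%E.
rewrite !normal_pdfE ?oner_eq0// mulrCA -expRD; congr (_ * expR _).
by field.
Qed.

End gaussian_tilting.

(** * Tonelli and densities for product laws *)

Section tuple_prob_integral.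
Context {d : measure_display} {T : measurableType d} {R : realType}.

Lemma ge0_integral_tuple_probS n (P : 'I_n.+1 -> probability T R)
    (f : n.+1.-tuple T -> \bar R) :
  measurable_fun [set: _] f -> (forall x, 0 <= f x)%E ->
  (\int[tuple_prob P]_x f x =
   \int[P ord0]_x \int[tuple_prob (fun i => P (lift ord0 i))]_t
     f (tuple_cons (x, t)))%E.
Proof.
move=> mf f0 /=.
rewrite (ge0_integral_pushforward (@measurable_tuple_cons _ T n))//.
rewrite preimage_setT fubini_tonelli1//.
  by apply: measurableT_comp => //; exact: measurable_tuple_cons.
by move=> x; exact: f0.
Qed.

(** Densities multiply under independence. By induction, Tonelli splits off the first coordinate,
    [PQ] tilts it and the induction hypothesis tilts the others. *)
Lemma ge0_integral_tuple_prob_tilt n (P Q : 'I_n -> probability T R)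
    (h : 'I_n -> T -> R) :
  (forall i, measurable_fun [set: T] (h i)) ->
  (forall i x, 0 <= h i x) ->
  (forall i (f : T -> \bar R), measurable_fun [set: T] f ->
     (forall x, 0 <= f x)%E ->
     (\int[Q i]_x f x = \int[P i]_x (f x * (h i x)%:E))%E) ->
  forall f : n.-tuple T -> \bar R,
  measurable_fun [set: _] f -> (forall x, 0 <= f x)%E ->
  (\int[tuple_prob Q]_x f x =
   \int[tuple_prob P]_x (f x * (\prod_i h i (tnth x i))%:E))%E.
Proof.
elim: n P Q h => [|n IHn] P Q h mh h0 PQ f mf f0.
  by apply: eq_integral => x _; rewrite big_ord0 mule1.
have mprod k (g : 'I_k -> T -> R) : (forall i, measurable_fun [set: T] (g i)) ->
    measurable_fun [set: _] (fun t : k.-tuple T => (\prod_i g i (tnth t i))%:E).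
  move=> mg; apply/measurable_EFinP; apply: measurable_prod => i _.
  by apply: measurableT_comp => //; exact: measurable_tnth.
have prod0 k (g : 'I_k -> T -> R) (t : k.-tuple T) : (forall i x, 0 <= g i x) ->
    (0 <= (\prod_i g i (tnth t i))%:E)%E.
  by move=> g0; rewrite lee_fin prodr_ge0.
have mc := @measurable_tuple_cons _ T n.
have mfc x : measurable_fun [set: _] (fun t => f (tuple_cons (x, t))).
  by apply: measurableT_comp => //; apply: measurableT_comp => //;
     exact: pair1_measurable.
rewrite !ge0_integral_tuple_probS//; last 2 first.
- by apply: emeasurable_funM => //; exact: mprod.
- by move=> x; rewrite mule_ge0 ?prod0.
(* [PQ] will be applied to the inner integral as a function of the first coordinate, so that
   function has to be measurable. *)
have mF (g : T -> n.-tuple T -> \bar R) (P' : probability (n.-tuple T) R) :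
    measurable_fun [set: T * n.-tuple T] (fun z => g z.1 z.2) ->
    (forall x t, 0 <= g x t)%E ->
    measurable_fun [set: T] (fun x => \int[P']_t g x t)%E.
  move=> mg g0.
  exact: (@measurable_fun_fubini_tonelli_F _ _ _ _ _ P' (fun z => g z.1 z.2)).
rewrite PQ; last 2 first.
- apply: mF => // ; rewrite (_ : (fun _ => _) = f \o @tuple_cons _ T n).
    exact: measurableT_comp.
  by apply/funext => -[].
- by move=> x; exact: integral_ge0.
apply: eq_integral => x _.
rewrite (IHn (fun i => P (lift ord0 i)) _ (fun i => h (lift ord0 i)))//;
  last first.
  by move=> i g; exact: PQ.
rewrite -ge0_integralZr//; last 3 first.
- by apply: emeasurable_funM => //; exact: (mprod n (fun i => h (lift ord0 i))).
- by move=> t _; rewrite mule_ge0// (prod0 n (fun i => h (lift ord0 i))).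
- by rewrite lee_fin.
apply: eq_integral => t _.
rewrite -muleA -EFinM big_ord_recl/= mulrC; congr (_ * (_ * _)%:E)%E.
by apply: eq_bigr => i _; rewrite tnthS.
Qed.

End tuple_prob_integral.

(** * Gaussian shifts of the null law and their likelihood ratios *)

Section gaussian_shift.
Context {R : realType} {n : nat}.
Local Notation TR := (measurableTypeR R).
Local Notation Rn := (n.-tuple TR).
Implicit Types t u : 'I_n -> R.

(** Covers [P0] (zero mean vector) and [PS mu S] (mean [mu] on [S], 0 elsewhere) at once. *)
Definition gauss_shift t : probability Rn R :=
  tuple_prob (fun i => normal_prob (t i) 1 : probability TR R).

Definition tuple_lr t x : R := \prod_i gauss_lr (t i) (tnth x i).

Lemma tuple_lr_ge0 t x : 0 <= tuple_lr t x.
Proof. by apply: prodr_ge0 => i _; exact: expR_ge0. Qed.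

Lemma measurable_tuple_lr t : measurable_fun [set: Rn] (tuple_lr t).
Proof.
apply: measurable_prod => i _; apply: measurableT_comp (measurable_tnth i).
exact: measurable_gauss_lr.
Qed.

Lemma ge0_integral_gauss_shift t (f : Rn -> \bar R) :
  measurable_fun [set: _] f -> (forall x, 0 <= f x)%E ->
  (\int[gauss_shift t]_x f x = \int[P0]_x (f x * (tuple_lr t x)%:E))%E.
Proof.
move=> mf f0; rewrite /tuple_lr /P0 /gauss_shift.
pose N01 := normal_prob 0 1 : probability TR R.
pose Nt i := normal_prob (t i) 1 : probability TR R.
have tilt i (g : R -> \bar R) : measurable_fun [set: R] g ->
    (forall y, 0 <= g y)%E ->
    (\int[Nt i]_y g y = \int[N01]_y (g y * (gauss_lr (t i) y)%:E))%E.
  exact: ge0_integral_normal_tilt.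
rewrite (@ge0_integral_tuple_prob_tilt _ TR R n (fun=> N01) Nt
  (fun i => gauss_lr (t i)) _ _ tilt f mf f0)// => [i|i y].
- exact: measurable_gauss_lr.
- exact: expR_ge0.
Qed.

Lemma gauss_shiftE t (A : set Rn) : measurable A ->
  gauss_shift t A = (\int[P0]_(x in A) (tuple_lr t x)%:E)%E.
Proof.
move=> mA.
have -> : gauss_shift t A = (\int[gauss_shift t]_x (\1_A x)%:E)%E.
  by rewrite integral_indic// setIT.
rewrite ge0_integral_gauss_shift.
- rewrite [RHS]integral_mkcond; apply: eq_integral => x _.
  by rewrite patchE indicE; case: ifPn => _; rewrite ?mul1e ?mul0e.
- by apply/measurable_EFinP; exact: measurable_indic.
- by move=> x; rewrite lee_fin indicE.
Qed.

Lemma integral_tuple_lr t : (\int[P0]_x (tuple_lr t x)%:E = 1)%E.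
Proof. by rewrite -gauss_shiftE ?probability_setT. Qed.

(** In each coordinate the exponents add up to that of mean [t i + u i], and the cross term of the
    square [(t i + u i) ^+ 2] leaves [t i * u i]. *)
Lemma tuple_lrM t u x : tuple_lr t x * tuple_lr u x =
  expR (\sum_i t i * u i) * tuple_lr (fun i => t i + u i) x.
Proof.
rewrite expR_sum /tuple_lr -!big_split/=; apply: eq_bigr => i _.
by rewrite -!expRD; congr expR; field.
Qed.

(** The factor that depends on [x] in [tuple_lrM] is again a likelihood ratio, of integral 1.
    Orthogonal shifts thus have uncorrelated likelihood ratios. *)
Lemma integral_tuple_lrM t u :
  (\int[P0]_x (tuple_lr t x * tuple_lr u x)%:E =
   (expR (\sum_i t i * u i))%:E)%E.
Proof.
under eq_integral do rewrite tuple_lrM EFinM.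
rewrite ge0_integralZl//; first by rewrite integral_tuple_lr mule1.
- by apply/measurable_EFinP; exact: measurable_tuple_lr.
- by move=> x _; rewrite lee_fin tuple_lr_ge0.
Qed.

End gaussian_shift.

(* [1_B (L - 1) <= a/2 (L - 1)^2 + 1/(2a)] integrated, with the negative terms
   moved across so that only nonnegative functions occur. *)
Lemma second_moment_bound d (T : measurableType d) (R : realType)
    (P : probability T R) (L : T -> R) (v a : R) (B : set T) :
  measurable_fun [set: T] L -> (forall x, 0 <= L x) ->
  (\int[P]_x (L x)%:E = 1)%E ->
  (\int[P]_x (L x ^+ 2)%:E <= (1 + v)%:E)%E ->
  0 < a -> measurable B ->
  (\int[P]_(x in B) (L x)%:E <= P B + (a / 2 * v + (2 * a)^-1)%:E)%E.
Proof.
move=> mL L0 EL EL2 a0 mB.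
have mI : measurable_fun [set: T] (fun x => (\1_B x)%:E : \bar R).
  by apply/measurable_EFinP; exact: measurable_indic.
have mLE : measurable_fun [set: T] (EFin \o L) by exact/measurable_EFinP.
have mL2 : measurable_fun [set: T] (fun x => (L x ^+ 2)%:E).
  by apply/measurable_EFinP; exact: measurable_funX.
have mIL : measurable_fun [set: T] (fun x => (\1_B x * L x)%:E).
  by apply/measurable_EFinP; apply: measurable_funM.
have I0 x : 0 <= \1_B x :> R by rewrite indicE.
set c := a / 2 + (2 * a)^-1.
have c0 : 0 <= c by rewrite addr_ge0 ?divr_ge0 ?invr_ge0 ?mulr_ge0 ?ltW.
have : (\int[P]_x ((\1_B x * L x)%:E + a%:E * (L x)%:E) <=
    \int[P]_x ((\1_B x)%:E + ((a / 2)%:E * (L x ^+ 2)%:E + c%:E)))%E.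
  apply: ge0_le_integral => //.
  - move=> x _; rewrite -EFinM -EFinD lee_fin addr_ge0// mulr_ge0//.
    exact: ltW.
  - by apply: emeasurable_funD => //; exact: measurable_funeM.
  - apply: emeasurable_funD => //; apply: emeasurable_funD => //.
    exact: measurable_funeM.
  - move=> x _; rewrite -!EFinM -!EFinD lee_fin -subr_ge0.
    have i2 : \1_B x * \1_B x = \1_B x :> R.
      by rewrite indicE; case: (x \in B); rewrite /= ?mulr0 ?mulr1.
    have i1 : \1_B x <= 1 :> R by rewrite indicE; case: (x \in B).
    set i : R := \1_B x in i2 i1 *.
    (* The term [- i * i] cancels the square of [i] in the expansion, so the identity is purely
       algebraic; that [i] is 0 or 1 serves only for the sign. *)
    rewrite (_ : _ - _ =
      (2 * a)^-1 * ((a * (L x - 1) - i) ^+ 2 + (1 - i * i))).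
      rewrite mulr_ge0 ?invr_ge0 ?mulr_ge0 ?(ltW a0)// addr_ge0 ?sqr_ge0//.
      by rewrite i2 subr_ge0.
    by rewrite /c; field; rewrite gt_eqF.
rewrite ge0_integralD//=; last 3 first.
- by move=> x _; rewrite lee_fin mulr_ge0.
- by move=> x _; rewrite -EFinM lee_fin mulr_ge0// ltW.
- exact: measurable_funeM.
rewrite ge0_integralZl//; last 2 first.
- by move=> x _; rewrite lee_fin.
- by rewrite lee_fin ltW.
rewrite EL mule1 ge0_integralD//; last 2 first.
- by move=> x _; rewrite -EFinM -EFinD lee_fin addr_ge0// mulr_ge0 ?sqr_ge0//
     divr_ge0 ?ltW.
- by apply: emeasurable_funD => //; exact: measurable_funeM.
rewrite ge0_integralD//; last 2 first.
- by move=> x _; rewrite -EFinM lee_fin mulr_ge0 ?sqr_ge0// divr_ge0 ?ltW.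
- exact: measurable_funeM.
rewrite ge0_integralZl//; last 2 first.
- by move=> x _; rewrite lee_fin sqr_ge0.
- by rewrite lee_fin divr_ge0 ?ltW.
rewrite integral_cst//= probability_setT mule1 integral_indic// setIT => H.
have IE : (\int[P]_x (\1_B x * L x)%:E = \int[P]_(x in B) (L x)%:E)%E.
  rewrite [RHS]integral_mkcond; apply: eq_integral => x _.
  by rewrite patchE indicE; case: ifPn; rewrite ?mul1r ?mul0r.
rewrite IE in H.
(* The summand [a] is the integral of [a * L]; it cancels because [a / 2 + c = a + (2 * a)^-1]. *)
rewrite -(leeD2rE (x := a%:E))//; apply: (le_trans H).
rewrite -addeA; apply: leeD2l.
apply: (@le_trans _ _ ((a / 2)%:E * (1 + v)%:E + c%:E)%E).
  by rewrite leeD2rE//; apply: lee_wpmul2l => //; rewrite lee_fin divr_ge0 ?ltW.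
by rewrite -EFinM -!EFinD lee_fin /c; lra.
Qed.

Lemma ge0_integral_sum_in d (T : measurableType d) (R : realType)
    (P : {measure set T -> \bar R}) (D : set T) (I : finType) (A : {set I})
    (f : I -> T -> R) : measurable D ->
  (forall i, measurable_fun [set: T] (f i)) -> (forall i x, 0 <= f i x) ->
  (\int[P]_(x in D) (\sum_(i in A) f i x)%:E =
   \sum_(i in A) \int[P]_(x in D) (f i x)%:E)%E.
Proof.
move=> mD mf f0; rewrite -[RHS]big_enum -ge0_integral_sum//=.
- by apply: eq_integral => x _; rewrite big_enum/= sumEFin.
- by move=> i; apply/measurable_EFinP; apply: measurable_funTS; exact: mf.
- by move=> i x _; rewrite lee_fin.
Qed.

(** * Lower bound on the risk for a class of disjoint sets *)

Section risk_lower_bound.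
Context {R : realType} {n : nat}.
Local Notation Rn := (n.-tuple (measurableTypeR R)).
Variables (mu a : R) (K : nat) (A : {set {set 'I_n}}).
Hypotheses (A_neq0 : A != finset.set0) (cardA : forall S, S \in A -> #|S| = K).
Hypothesis disjA :
  forall S T i, S \in A -> T \in A -> i \in S -> i \in T -> S = T.
Hypothesis a0 : 0 < a.

Let shift (S : {set 'I_n}) (i : 'I_n) : R := if i \in S then mu else 0.

Let N : R := #|A|%:R.

Let N0 : 0 < N.
Proof. by rewrite ltr0n card_gt0. Qed.

(** The density with respect to [P0] of the uniform mixture of the laws [PS mu S]. *)
Let mix (x : Rn) : R := N^-1 * \sum_(S in A) tuple_lr (shift S) x.

Let mlr S : measurable_fun [set: Rn] (tuple_lr (shift S)).
Proof. exact: measurable_tuple_lr. Qed.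

Let sum_lr_ge0 x : 0 <= \sum_(S in A) tuple_lr (shift S) x.
Proof. by apply: sumr_ge0 => S _; exact: tuple_lr_ge0. Qed.

Let msum_lr : measurable_fun [set: Rn]
  (fun x => \sum_(S in A) tuple_lr (shift S) x).
Proof.
under eq_fun do rewrite -big_enum.
exact: measurable_sum.
Qed.

Let integral_mix (B : set Rn) : measurable B ->
  (\int[P0]_(x in B) (mix x)%:E =
   (N^-1 * \sum_(S in A) fine (PS mu S B))%:E)%E.
Proof.
move=> mB; under eq_integral do rewrite /mix EFinM.
rewrite ge0_integralZl//; last 3 first.
- by apply/measurable_EFinP; apply: measurable_funTS; exact: msum_lr.
- by move=> x _; rewrite lee_fin.
- by rewrite lee_fin invr_ge0 ltW.
rewrite ge0_integral_sum_in//; last by move=> S x; exact: tuple_lr_ge0.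
rewrite EFinM -sumEFin; congr (_ * _)%E; apply: eq_bigr => S _.
by rewrite -gauss_shiftE// fineK// fin_num_measure.
Qed.

(** Disjointness enters here: distinct members of [A] share no coordinate, so every product in the
    sum vanishes. *)
Let sum_shiftM S T : S \in A -> T \in A ->
  \sum_i shift S i * shift T i = if S == T then mu ^+ 2 * K%:R else 0.
Proof.
move=> SA TA; case: eqVneq => [<-|/eqP ST]; last first.
  apply: big1 => i _; rewrite /shift; case: ifPn => iS; last by rewrite mul0r.
  by case: ifPn => iT; [case: ST; exact: disjA iS iT|rewrite mulr0].
rewrite -(cardA SA) mulr_natr -sumr_const [RHS]big_mkcond/=.
by apply: eq_bigr => i _; rewrite /shift; case: ifP; rewrite ?mul0r// expr2.
Qed.

(** Expanding the square gives [N] diagonal terms equal to [expR (mu ^+ 2 * K%:R)] and fewer than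
    [N ^+ 2] off-diagonal terms equal to 1; division by [N ^+ 2] gives the bound. *)
Let integral_mix2 :
  (\int[P0]_x (mix x ^+ 2)%:E <= (1 + expR (mu ^+ 2 * K%:R) / N)%:E)%E.
Proof.
have mixE x : mix x ^+ 2 = (N ^+ 2)^-1 *
    \sum_(S in A) \sum_(T in A) tuple_lr (shift S) x * tuple_lr (shift T) x.
  by rewrite exprMn exprVn; congr (_ * _); rewrite expr2 big_distrlr.
have mlrM S T : measurable_fun [set: Rn]
    (fun x => tuple_lr (shift S) x * tuple_lr (shift T) x).
  exact: measurable_funM.
have lrM0 S T (x : Rn) : 0 <= tuple_lr (shift S) x * tuple_lr (shift T) x.
  by rewrite mulr_ge0 ?tuple_lr_ge0.
have msum S : measurable_fun [set: Rn] (fun x =>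
    \sum_(T in A) tuple_lr (shift S) x * tuple_lr (shift T) x).
  by under eq_fun do rewrite -big_enum; exact: measurable_sum.
have sum0 S (x : Rn) :
    0 <= \sum_(T in A) tuple_lr (shift S) x * tuple_lr (shift T) x.
  exact: sumr_ge0.
under eq_integral do rewrite mixE EFinM.
rewrite ge0_integralZl//; last 3 first.
- apply/measurable_EFinP; under eq_fun do rewrite -big_enum.
  exact: measurable_sum.
- by move=> x _; rewrite lee_fin sumr_ge0.
- by rewrite lee_fin invr_ge0 sqr_ge0.
rewrite ge0_integral_sum_in//.
have -> : (\sum_(S in A) \int[P0]_x
    (\sum_(T in A) tuple_lr (shift S) x * tuple_lr (shift T) x)%:E =
    (\sum_(S in A) \sum_(T in A) expR (\sum_i shift S i * shift T i))%:E)%E.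
  rewrite -sumEFin; apply: eq_bigr => S _.
  rewrite ge0_integral_sum_in// -sumEFin.
  by apply: eq_bigr => T _; rewrite integral_tuple_lrM.
rewrite -EFinM lee_fin.
apply: (@le_trans _ _ ((N ^+ 2)^-1 * (N * (expR (mu ^+ 2 * K%:R) + N)))).
  rewrite ler_wpM2l ?invr_ge0 ?sqr_ge0// [leRHS]mulr_natl -sumr_const.
  apply: ler_sum => S SA; rewrite (bigD1 S)//= sum_shiftM// eqxx lerD2l.
  (* The [N - 1] off-diagonal terms of the row are bounded by [N]. *)
  apply: (@le_trans _ _ (\sum_(T in A) 1)); last by rewrite sumr_const.
  rewrite [leRHS](bigD1 S)//= -[leLHS]add0r lerD// ler_sum// => T /andP[TA TS].
  by rewrite sum_shiftM// eq_sym (negbTE TS) expR0.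
by rewrite le_eqVlt; apply/orP; left; apply/eqP; field; rewrite gt_eqF.
Qed.

(** A test rejecting on [B] has risk 1 minus the excess of the mixture's mass of [B] over [P0 B],
    and [second_moment_bound] controls this excess uniformly in [B]. The parameter [a] stays free,
    to be tuned later. *)
Lemma optimal_risk_disjoint_ge :
  1 - (a / 2 * (expR (mu ^+ 2 * K%:R) / #|A|%:R) + (2 * a)^-1) <=
  optimal_risk mu A.
Proof.
apply: lb_le_inf => [|_ [f mf <-]].
  by exists (risk mu A (fun=> true)), (fun=> true); first exact: measurable_cst.
set B := [set x | f x = true].
have mB : measurable B by rewrite -[B]setTI; exact: (mf _ [set true]).
have Bc : [set x | f x = false] = ~` B.
  by apply/seteqP; split=> x /=; rewrite /B /=; case: (f x).
have mmix : measurable_fun [set: Rn] mix by exact: measurable_funM.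
have mix0 x : 0 <= mix x.
  by apply: mulr_ge0; rewrite ?invr_ge0 ?sum_lr_ge0// ltW.
have mix1 : (\int[P0]_x (mix x)%:E = 1)%E.
  rewrite integral_mix//; under eq_bigr do rewrite probability_setT.
  by rewrite sumr_const -/N mulVf ?gt_eqF.
have := second_moment_bound mmix mix0 mix1 integral_mix2 a0 mB.
rewrite integral_mix// -(fineK (fin_num_measure P0 B mB)) -EFinD lee_fin => H.
have PSc S : fine (PS mu S (~` B)) = 1 - fine (PS mu S B).
  by rewrite probability_setC// fineB// fin_num_measure.
rewrite /risk -/B Bc; under [in leRHS]eq_bigr do rewrite PSc.
rewrite sumrB sumr_const mulrBr -/N mulVf ?gt_eqF//.
move: H; rewrite -/N; lra.
Qed.

End risk_lower_bound.

(** * Upper bound on the risk when most members share a point *)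

Section risk_upper_bound.
Context {R : realType} {n : nat}.
Local Notation TR := (measurableTypeR R).
Local Notation Rn := (n.-tuple TR).

Lemma gauss_shift_tnth (t : 'I_n -> R) (i0 : 'I_n) (E : set TR) :
  measurable E ->
  gauss_shift t [set x | E (tnth x i0)] = normal_prob (t i0) 1 E.
Proof.
move=> mE; pose D i : set TR := if i == i0 then E else setT.
have -> : [set x : Rn | E (tnth x i0)] = [set x | forall i, D i (tnth x i)].
  apply/seteqP; split => x /= => [Ex i|/(_ i0)]; rewrite /D ?eqxx//.
  by case: eqP => [->|].
rewrite tuple_probE; last by move=> i; rewrite /D; case: ifP.
rewrite (bigD1 i0)//= [X in (_ * X)%E]big1 ?mule1; first by rewrite /D eqxx.
by move=> i /negbTE ii0; rewrite /D ii0 probability_setT.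
Qed.

(** A Chernoff bound in change-of-measure form: integrating the comparison over [E] gives at most
    [c] times the mass of [E] under mean [s], which is at most 1. *)
Lemma normal_prob_le_lr (s t c : R) (E : set TR) : measurable E -> 0 <= c ->
  (forall y, E y -> gauss_lr t y <= c * gauss_lr s y) ->
  (normal_prob t 1 E <= c%:E)%E.
Proof.
move=> mE c0 Ec; pose Nm m := normal_prob m 1 : probability TR R.
have mIlr u (F : set TR) : measurable F ->
    measurable_fun [set: TR] (fun y => (\1_F y * gauss_lr u y)%:E).
  move=> mF; apply/measurable_EFinP; apply: measurable_funM.
    exact: measurable_indic.
  exact: measurable_gauss_lr.
have Ilr0 u (F : set TR) y : (0 <= (\1_F y * gauss_lr u y)%:E :> \bar R)%E.
  by rewrite lee_fin mulr_ge0 ?expR_ge0// indicE.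
have NmE u (F : set TR) : measurable F ->
    Nm u F = (\int[Nm 0%R]_y (\1_F y * gauss_lr u y)%:E)%E.
  move=> mF; have -> : Nm u F = (\int[Nm u]_y (\1_F y)%:E)%E.
    by rewrite integral_indic// setIT.
  rewrite ge0_integral_normal_tilt.
  - by under eq_integral do rewrite -EFinM.
  - by apply/measurable_EFinP; exact: measurable_indic.
  - by move=> y; rewrite lee_fin indicE.
rewrite -[leLHS]/(Nm t E) -[leRHS]mule1.
rewrite -[X in (_ <= _ * X)%E](probability_setT (Nm s)).
rewrite (NmE t E mE) (NmE s setT measurableT).
rewrite -ge0_integralZl//; last exact: mIlr.
apply: ge0_le_integral => //.
- exact: mIlr.
- by apply: measurable_funeM; exact: mIlr.
- move=> y _; rewrite -EFinM lee_fin indicT mul1r indicE.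
  case: (boolP (y \in E)) => [/set_mem /Ec|_]; first by rewrite mul1r.
  by rewrite mul0r mulr_ge0// expR_ge0.
Qed.

(** The test thresholds coordinate [i0] at [mu / 2]. Each error probability at [i0] is at most the
    exponential term; members of [A] are charged the trivial bound 1, which averages to at most
    [#|A| / #|C|]. *)
Lemma optimal_risk_core_le (mu : R) (i0 : 'I_n) (A C : {set {set 'I_n}}) :
  0 < mu -> A \subset C -> (0 < #|C|)%N ->
  (forall S, S \in C -> S \notin A -> i0 \in S) ->
  optimal_risk mu C <= 2 * expR (- (mu ^+ 2 / 8)) + #|A|%:R / #|C|%:R.
Proof.
move=> mu0 AC C0 coreC; set q := expR _.
have q0 : 0 <= q by exact: expR_ge0.
pose f (x : Rn) := mu / 2 < tnth x i0.
have mf : measurable_fun [set: Rn] f.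
  by apply: measurable_fun_ltr => //; exact: measurable_tnth.
have mI1 : measurable [set y : TR | mu / 2 < y].
  by rewrite -set_itv_o_infty; exact: measurable_itv.
have mI2 : measurable [set y : TR | y <= mu / 2].
  by rewrite -set_itv_infty_c; exact: measurable_itv.
(* Both error probabilities are compared with the intermediate mean mu/2, which
   balances the two Chernoff exponents at mu^2/8. *)
have P0f : fine (P0 [set x : Rn | f x = true]) <= q.
  rewrite -lee_fin fineK ?fin_num_measure//; last first.
    by rewrite -[X in measurable X]setTI; exact: (mf _ [set true]).
  rewrite -[leLHS]/(gauss_shift (fun=> 0)
    [set x | [set y | mu / 2 < y] (tnth x i0)]).
  rewrite gauss_shift_tnth//.
  apply: (@normal_prob_le_lr (mu / 2)) => // y /= muy.
  rewrite -expRD ler_expR; nra.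
have fE : [set x : Rn | f x = false] =
    [set x | [set y | y <= mu / 2] (tnth x i0)].
  by apply/seteqP; split=> x /=; rewrite /f leNgt; case: (_ < _).
have PSf S : S \in C -> fine (PS mu S [set x : Rn | f x = false]) <=
    (S \in A)%:R + q.
  move=> SC; have mff : measurable [set x : Rn | f x = false].
    by rewrite -[X in measurable X]setTI; exact: (mf _ [set false]).
  case: (boolP (S \in A)) => SA.
    rewrite ler_wpDr// -lee_fin fineK ?fin_num_measure//.
    exact: probability_le1.
  rewrite add0r -lee_fin fineK ?fin_num_measure// fE.
  rewrite (gauss_shift_tnth (fun i => if i \in S then mu else 0))//.
  rewrite (coreC S SC SA).
  apply: (@normal_prob_le_lr (mu / 2)) => // y /= muy.
  rewrite -expRD ler_expR; nra.
apply: (@le_trans _ _ (risk mu C f)).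
  by apply: ge_inf; [exists 0 => _ [g _ <-]; exact: risk_ge0|exists f].
have C0' : 0 < #|C|%:R :> R by rewrite ltr0n.
apply: (@le_trans _ _ (q + #|C|%:R^-1 * (#|A|%:R + q * #|C|%:R))).
  apply: lerD => //; rewrite ler_wpM2l ?invr_ge0 ?(ltW C0')//.
  apply: (@le_trans _ _ (\sum_(S in C) ((S \in A)%:R + q))).
    by apply: ler_sum => S; exact: PSf.
  rewrite big_split/= sumr_const mulr_natr lerD2r -natr_sum ler_nat.
  rewrite -sum1_card big_mkcond [leqRHS]big_mkcond/= leq_sum// => S _.
  by case: (S \in C); case: (S \in A).
by rewrite le_eqVlt; apply/orP; left; apply/eqP; field; rewrite gt_eqF.
Qed.

End risk_upper_bound.

(** * The two families of pairs *)

Section pairs_and_star.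
Variable m : nat.

(** Numbering from 1 leaves 0 as the centre of [star]. The values of [inord] are the intended ones
    when [N.*2 <= m]; beyond the range it falls back to a default. *)
Definition consecutive_pairs N : {set {set 'I_m.+1}} :=
  [set [set inord i.*2.+1; inord i.*2.+2] | i : 'I_N]%SET.

Definition star : {set {set 'I_m.+1}} :=
  [set [set ord0; lift ord0 j] | j : 'I_m]%SET.

Let consecutive_pair_mem N (i : 'I_N) (j : 'I_m.+1) : (N.*2 <= m)%N ->
  (j \in [set inord i.*2.+1; inord i.*2.+2]%SET) =
  (j == i.*2.+1 :> nat) || (j == i.*2.+2 :> nat).
Proof.
move=> Nm; have iN := ltn_ord i.
by rewrite !inE -!val_eqE /= !inordK//; lia.
Qed.

Lemma consecutive_pairs_disjoint N S T (j : 'I_m.+1) : (N.*2 <= m)%N ->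
  S \in consecutive_pairs N -> T \in consecutive_pairs N ->
  j \in S -> j \in T -> S = T.
Proof.
move=> Nm /imsetP[i _ ->] /imsetP[k _ ->].
rewrite !consecutive_pair_mem// => ji jk.
suff -> : i = k by [].
(* Both [i] and [k] are the integer half of [j - 1]. *)
by apply/val_inj => /=; lia.
Qed.

Lemma card_consecutive_pair N S : (N.*2 <= m)%N ->
  S \in consecutive_pairs N -> #|S| = 2.
Proof.
move=> Nm /imsetP[i _ ->]; have iN := ltn_ord i.
by rewrite cards2 -val_eqE /= !inordK; [rewrite eqn_leq ltnn andbF|lia|lia].
Qed.

Lemma card_consecutive_pairs N : (N.*2 <= m)%N -> #|consecutive_pairs N| = N.
Proof.
move=> Nm; rewrite card_imset ?card_ord// => i k /= ik.
have iN := ltn_ord i.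
(* The odd element identifies the pair: if it also lies in the pair of [k], parity forces
   [i = k]. *)
have : (inord i.*2.+1 : 'I_m.+1) \in [set inord i.*2.+1; inord i.*2.+2]%SET.
  by rewrite !inE eqxx.
rewrite ik consecutive_pair_mem// inordK; last by lia.
by move=> H; apply/val_inj => /=; lia.
Qed.

Lemma card_star_mem S : S \in star -> #|S| = 2.
Proof. by case/imsetP=> j _ ->; rewrite cards2 neq_lift. Qed.

Lemma card_star : #|star| = m.
Proof.
rewrite card_imset ?card_ord// => i j /= /setP /(_ (lift ord0 i)).
rewrite !inE eqxx orbT eq_sym (negbTE (neq_lift _ _))/=.
by move/esym/eqP/lift_inj.
Qed.

Lemma star_ord0 S : S \in star -> ord0 \in S.
Proof. by case/imsetP=> j _ ->; rewrite !inE eqxx. Qed.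

End pairs_and_star.

(** * Choice of the parameters *)

Theorem theorem5p2 (R : realType) (eps : R) :
  0 < eps < 1 ->
  exists (n K : nat) (mu : R) (A C : {set {set 'I_n}}),
    [/\ (0 < n)%N, (0 < K)%N & 0 < mu] /\
    [/\ A != finset.set0, A \subset C & forall S, S \in C -> #|S| = K] /\
    1 - eps <= optimal_risk mu A /\ optimal_risk mu C <= 2 * eps.
Proof.
move=> /andP[e0 e1].
(* This [mu] makes [mu ^+ 2 / 8] equal to [2 / eps ^+ 2], large enough for the tail bound below; [c]
   is the second moment of one likelihood ratio for [K = 2]. *)
pose mu := 4 / eps; pose c := expR (mu ^+ 2 * 2%:R).
have mu0 : 0 < mu by rewrite divr_gt0.
pose N := (Num.truncn (c / eps ^+ 2)).+1.
have cN : c <= eps ^+ 2 * N%:R.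
  rewrite mulrC -ler_pdivrMr ?exprn_gt0//; apply/ltW.
  exact: truncnS_gt.
(* Large enough both to hold [N] disjoint pairs besides 0 and to make [N] at most [eps * m]. *)
pose m := (N.*2 + Num.truncn (N%:R / eps)).+1.
have Nm : (N.*2 <= m)%N by rewrite /m -addnS leq_addr.
have Nem : N%:R <= eps * m%:R :> R.
  rewrite mulrC -ler_pdivrMr//; apply: (le_trans (ltW (truncnS_gt _))).
  by rewrite ler_nat /m -addnS leq_addl.
have N0 : 0 < N%:R :> R by rewrite ltr0n.
pose A := consecutive_pairs m N; pose C := (A :|: star m)%SET.
have cardA : #|A| = N by exact: card_consecutive_pairs.
have mC : (m <= #|C|)%N.
  by rewrite -[X in (X <= _)%N](card_star m) subset_leq_card// finset.subsetUr.
have C0 : (0 < #|C|)%N by apply: leq_trans mC.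
have AC : A \subset C by exact: finset.subsetUl.
exists m.+1, 2, mu, A, C; split=> //; split.
  split=> //; first by rewrite -card_gt0 cardA.
  by move=> S; rewrite inE => /orP[/(card_consecutive_pair Nm)|/card_star_mem].
split.
  (* With [a = eps^-1] and [c / N <= eps ^+ 2], each of the two error terms is at most [eps / 2]. *)
  apply: (le_trans _ (@optimal_risk_disjoint_ge R _ mu eps^-1 2 A _ _ _ _)).
  - rewrite cardA -/c lerD2l lerN2.
    have : c / N%:R <= eps ^+ 2 by rewrite ler_pdivrMr.
    have a0 : 0 <= eps^-1 / 2 by rewrite divr_ge0 ?invr_ge0 ?ltW.
    move=> /(ler_wpM2l a0).
    rewrite (_ : eps^-1 / 2 * eps ^+ 2 = eps / 2); last first.
      by field; rewrite gt_eqF.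
    rewrite (_ : (2 * eps^-1)^-1 = eps / 2); last by field; rewrite gt_eqF.
    lra.
  - by rewrite -card_gt0 cardA.
  - by move=> S; exact: card_consecutive_pair.
  - by move=> S T j; exact: consecutive_pairs_disjoint.
  - by rewrite invr_gt0.
apply: (le_trans (@optimal_risk_core_le R _ mu ord0 A C mu0 AC C0 _)).
  by move=> S; rewrite inE => /orP[->//|/star_ord0].
rewrite cardA.
(* After inversion, [expR x >= 1 + x] at [x = 2 / eps ^+ 2] suffices, since this exceeds [2 / eps]
   for [eps < 1]. Twice the tail and the fraction of [A] in [C] then contribute [eps] each. *)
have tail : expR (- (mu ^+ 2 / 8)) <= eps / 2.
  rewrite expRN -[leRHS]invrK lef_pV2 ?posrE ?expR_gt0 ?invr_gt0 ?divr_gt0//.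
  apply: le_trans (expR_ge1Dx _).
  have i1 : 1 < eps^-1 by rewrite invf_gt1.
  rewrite (_ : (eps / 2)^-1 = 2 * eps^-1); last by field; rewrite gt_eqF.
  rewrite (_ : mu ^+ 2 / 8 = 2 * (eps^-1 * eps^-1)); last first.
    by rewrite /mu; field; rewrite gt_eqF.
  nra.
have : N%:R / #|C|%:R <= eps.
  rewrite ler_pdivrMr ?ltr0n//; apply: (le_trans Nem).
  by rewrite ler_wpM2l ?ler_nat// ltW.
lra.
Qed.
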